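(* Let $f\in\mathbb H^{N_1\times N_2}$ be a quaternion-valued signal with DQQPFT $\mathcal Q^{\mathbb H}_{\mathfrak B_1\mathfrak B_2}[f](\omega_1,\omega_2)$. Then $f$ can be reconstructed by $$f(\epsilon_1,\epsilon_2)=\frac1{\sqrt{N_1}}\frac1{\sqrt{N_2}}\sum_{\omega_1=0}^{N_1-1}\sum_{\omega_2=0}^{N_2-1}e^{i(a_1\epsilon_1^2\Delta t_1^2+\frac{2\pi}{N_1}\epsilon_1\omega_1+c_1\omega_1^2\Delta u_1^2+d_1\epsilon_1\Delta t_1+e_1\omega_1\Delta u_1)}\,\mathcal Q^{\mathbb H}_{\mathfrak B_1\mathfrak B_2}[f](\omega_1,\omega_2)\,e^{j(a_2\epsilon_2^2\Delta t_2^2+\frac{2\pi}{N_2}\epsilon_2\omega_2+c_2\omega_2^2\Delta u_2^2+d_2\epsilon_2\Delta t_2+e_2\omega_2\Delta u_2)}$$ for all $\epsilon_s\in\{0,\dots,N_s-1\}$, $s=1,2$.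
   Context: $\mathbb H$ is the algebra of real quaternions with units $i,j,k$, $i^2=j^2=k^2=ijk=-1$, $ij=-ji=k$. Fix positive integers $N_1,N_2$. For $s=1,2$ let $\mathfrak B_s=(a_s,b_s,c_s,d_s,e_s)$ be real parameters with $b_s\neq 0$, let $\Delta t_s>0$ be a sampling interval and $\Delta u_s=2\pi b_s/(N_s\Delta t_s)$. A signal $f\in\mathbb H^{N_1\times N_2}$ is an array of quaternions $f(\xi_1,\xi_2)$, $\xi_s\in\{0,\dots,N_s-1\}$. Its two-sided discrete quaternion quadratic phase Fourier transform (DQQPFT) is $$\mathcal Q^{\mathbb H}_{\mathfrak B_1\mathfrak B_2}[f](\omega_1,\omega_2)=\frac1{\sqrt{N_1N_2}}\sum_{\xi_1=0}^{N_1-1}\sum_{\xi_2=0}^{N_2-1}e^{-i(a_1\xi_1^2\Delta t_1^2+\frac{2\pi}{N_1}\xi_1\omega_1+c_1\omega_1^2\Delta u_1^2+d_1\xi_1\Delta t_1+e_1\omega_1\Delta u_1)}f(\xi_1,\xi_2)\,e^{-j(a_2\xi_2^2\Delta t_2^2+\frac{2\pi}{N_2}\xi_2\omega_2+c_2\omega_2^2\Delta u_2^2+d_2\xi_2\Delta t_2+e_2\omega_2\Delta u_2)},$$ for $\omega_s\in\{0,\dots,N_s-1\}$, where for real $x$, $e^{\pm ix}=\cos x\pm i\sin x$ and $e^{\pm jx}=\cos x\pm j\sin x$. *)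

(* Defs.v *)
From HB Require Import structures.
From mathcomp Require Import all_boot all_order all_algebra.
From mathcomp Require Import ring.
From mathcomp Require Import reals trigo.

Set Implicit Arguments.
Unset Strict Implicit.
Unset Printing Implicit Defensive.

Import Order.TTheory GRing.Theory Num.Theory.
Local Open Scope ring_scope.

(* [Quat p q r s] is p + q i + r j + s k. *)
Record quat (R : realType) : Type := Quat { qre : R; qim_i : R; qim_j : R; qim_k : R }.

Section QuaternionAlgebra.
Variable R : realType.
Implicit Types (x y z : quat R) (t u : R).

Definition quat_to_tuple x := (qre x, qim_i x, qim_j x, qim_k x).
Definition tuple_to_quat (v : R * R * R * R) :=
  Quat v.1.1.1 v.1.1.2 v.1.2 v.2.

Lemma quat_to_tupleK : cancel quat_to_tuple tuple_to_quat.
Proof. by case. Qed.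

HB.instance Definition _ := Choice.copy (quat R) (can_type quat_to_tupleK).

Definition addq x y :=
  Quat (qre x + qre y) (qim_i x + qim_i y) (qim_j x + qim_j y) (qim_k x + qim_k y).
Definition oppq x := Quat (- qre x) (- qim_i x) (- qim_j x) (- qim_k x).
Definition zeroq : quat R := Quat 0 0 0 0.
Definition oneq : quat R := Quat 1 0 0 0.
Definition scaleq t x :=
  Quat (t * qre x) (t * qim_i x) (t * qim_j x) (t * qim_k x).
Definition mulq x y := Quat
  (qre x * qre y - qim_i x * qim_i y - qim_j x * qim_j y - qim_k x * qim_k y)
  (qre x * qim_i y + qim_i x * qre y + qim_j x * qim_k y - qim_k x * qim_j y)
  (qre x * qim_j y - qim_i x * qim_k y + qim_j x * qre y + qim_k x * qim_i y)
  (qre x * qim_k y + qim_i x * qim_j y - qim_j x * qim_i y + qim_k x * qre y).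

Fact addqA : associative addq.
Proof. by case=> ? ? ? ? [? ? ? ?] [? ? ? ?]; rewrite /addq /= !addrA. Qed.
Fact addqC : commutative addq.
Proof. by case=> ? ? ? ? [? ? ? ?]; congr Quat; rewrite /= addrC. Qed.
Fact add0q : left_id zeroq addq.
Proof. by case=> ? ? ? ?; rewrite /addq /= !add0r. Qed.
Fact addNq : left_inverse zeroq oppq addq.
Proof. by case=> ? ? ? ?; rewrite /addq /= !addNr. Qed.

HB.instance Definition _ :=
  GRing.isZmodule.Build (quat R) addqA addqC add0q addNq.

Fact mulqA : associative mulq.
Proof. by case=> ? ? ? ? [? ? ? ?] [? ? ? ?]; rewrite /mulq /=; congr Quat; ring. Qed.
Fact mul1q : left_id oneq mulq.
Proof. by case=> ? ? ? ?; rewrite /mulq /=; congr Quat; ring. Qed.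
Fact mulq1 : right_id oneq mulq.
Proof. by case=> ? ? ? ?; rewrite /mulq /=; congr Quat; ring. Qed.
Fact mulqDl : left_distributive mulq addq.
Proof. by case=> ? ? ? ? [? ? ? ?] [? ? ? ?]; rewrite /mulq /addq /=; congr Quat; ring. Qed.
Fact mulqDr : right_distributive mulq addq.
Proof. by case=> ? ? ? ? [? ? ? ?] [? ? ? ?]; rewrite /mulq /addq /=; congr Quat; ring. Qed.
Fact oneq_neq0 : oneq != zeroq.
Proof. by apply/eqP => -[] /eqP; rewrite oner_eq0. Qed.

HB.instance Definition _ :=
  GRing.Zmodule_isNzRing.Build (quat R) mulqA mul1q mulq1 mulqDl mulqDr oneq_neq0.

Fact scaleqA t u x : scaleq t (scaleq u x) = scaleq (t * u) x.
Proof. by rewrite /scaleq /= !mulrA. Qed.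
Fact scale1q : left_id 1 scaleq.
Proof. by case=> ? ? ? ?; rewrite /scaleq /= !mul1r. Qed.
Fact scaleqDr : right_distributive scaleq +%R.
Proof. by move=> ? [? ? ? ?] [? ? ? ?]; rewrite /scaleq /=; congr Quat; rewrite /= mulrDr. Qed.
Fact scaleqDl x : {morph scaleq^~ x : t u / t + u}.
Proof. by move=> t u; case: x => ? ? ? ?; congr Quat; rewrite /= mulrDl. Qed.

HB.instance Definition _ :=
  GRing.Zmodule_isLmodule.Build R (quat R) scaleqA scale1q scaleqDr scaleqDl.

Fact scaleqAl t x y : t *: (x * y) = t *: x * y.
Proof. by case: x y => ? ? ? ? [? ? ? ?]; congr Quat; rewrite /=; ring. Qed.

HB.instance Definition _ := GRing.Lmodule_isLalgebra.Build R (quat R) scaleqAl.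

Fact scaleqAr t x y : t *: (x * y) = x * (t *: y).
Proof. by case: x y => ? ? ? ? [? ? ? ?]; congr Quat; rewrite /=; ring. Qed.

HB.instance Definition _ := GRing.Lalgebra_isAlgebra.Build R (quat R) scaleqAr.

Definition qi : quat R := Quat 0 1 0 0.
Definition qj : quat R := Quat 0 0 1 0.
Definition qk : quat R := Quat 0 0 0 1.

Lemma quatE x : x = (qre x)%:A + qim_i x *: qi + qim_j x *: qj + qim_k x *: qk.
Proof. by case: x => ? ? ? ?; congr Quat; rewrite /=; ring. Qed.
Lemma qi_sqr : qi * qi = -1. Proof. by congr Quat; rewrite /=; ring. Qed.
Lemma qj_sqr : qj * qj = -1. Proof. by congr Quat; rewrite /=; ring. Qed.
Lemma qk_sqr : qk * qk = -1. Proof. by congr Quat; rewrite /=; ring. Qed.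
Lemma qijk : qi * qj * qk = -1. Proof. by congr Quat; rewrite /=; ring. Qed.
Lemma qij : qi * qj = qk. Proof. by congr Quat; rewrite /=; ring. Qed.
Lemma qji : qj * qi = - qk. Proof. by congr Quat; rewrite /=; ring. Qed.

(* e^{i t} and e^{j t} *)
Definition expi t : quat R := (cos t)%:A + sin t *: qi.
Definition expj t : quat R := (cos t)%:A + sin t *: qj.

Lemma expiN t : expi (- t) = (cos t)%:A - sin t *: qi.
Proof. by rewrite /expi cosN sinN scaleNr. Qed.
Lemma expjN t : expj (- t) = (cos t)%:A - sin t *: qj.
Proof. by rewrite /expj cosN sinN scaleNr. Qed.

End QuaternionAlgebra.

(* The parameter tuple (a, b, c, d, e); b <> 0 is assumed where it is needed. *)
Record qpf_param (R : realType) : Type := QpfParam { pa : R; pb : R; pc : R; pd : R; pe : R }.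

Section Transform.
Variable R : realType.

Definition freq_step (N : nat) (B : qpf_param R) (dt : R) : R :=
  2 * pi * pb B / (N%:R * dt).

Definition qpf_phase (N : nat) (B : qpf_param R) (dt : R) (x w : 'I_N) : R :=
  let du := freq_step N B dt in
  pa B * x%:R ^+ 2 * dt ^+ 2 + 2 * pi / N%:R * x%:R * w%:R
  + pc B * w%:R ^+ 2 * du ^+ 2 + pd B * x%:R * dt + pe B * w%:R * du.

Definition dqqpft (N1 N2 : nat) (B1 B2 : qpf_param R) (dt1 dt2 : R)
    (f : 'M[quat R]_(N1, N2)) : 'M[quat R]_(N1, N2) :=
  \matrix_(w1 < N1, w2 < N2)
    ((Num.sqrt (N1 * N2)%:R)^-1 *:
      \sum_(x1 < N1) \sum_(x2 < N2)
        expi (- qpf_phase B1 dt1 x1 w1) * f x1 x2 * expj (- qpf_phase B2 dt2 x2 w2)).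

End Transform.

(* Main.v *)
Require Import Defs.
From mathcomp Require Import all_boot all_order all_algebra.
From mathcomp Require Import reals trigo.
From mathcomp Require Import ring lra.

Set Implicit Arguments.
Unset Strict Implicit.
Unset Printing Implicit Defensive.

Import Order.TTheory GRing.Theory Num.Theory.
Local Open Scope ring_scope.

(** The transform is a product of three quaternion matrices: up to the factor
    [1 / sqrt (N1 * N2)] it sends [f] to [E1 *m f *m E2], where [E1] has the
    entries [expi (- phase)] and [E2] the entries [expj (- phase)].  The
    reconstruction formula multiplies by the kernels of opposite sign on the
    same two sides, so that noncommutativity never intervenes: matrix
    multiplication is associative over any ring, and it suffices that each
    kernel times its opposite is [N] times the identity
    ([qpf_kernel_mulmxV], [qpf_kernel_mulmxV_tr]).

    Each of these two products involves a single imaginary unit [u], with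
    [u * u = -1], so that [t |-> cos t + sin t * u] is a character of the real
    line.  For fixed [x] and [y] the chirp and modulation terms of
    [phase x w - phase y w] either cancel (those in [w] only) or do not depend on
    [w] (those in [x] and [y] only), and there remains the character sum
    over [w < N] at the angle [2 pi (x - y) / N].  It equals [N] when [x = y];
    otherwise it is a geometric sum whose ratio is a nontrivial [N]-th root of
    unity, hence zero ([sum_cis_roots_of_unity]). *)

Section Cis.
Variables (R : realType) (A : algType R) (u : A).
Implicit Types s t : R.

(** With [u] equal to [qi R] or [qj R] this is, by conversion, [expi] or
    [expj], so the two sides of the transform share one theory. *)
Definition cis t : A := (cos t)%:A + sin t *: u.

Lemma cis0 : cis 0 = 1.
Proof. by rewrite /cis cos0 sin0 scale1r scale0r addr0. Qed.

Lemma addr_cisN t : cis t + cis (- t) = (cos t *+ 2)%:A.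
Proof. by rewrite /cis cosN sinN scaleNr addrACA subrr addr0 -mulr2n scalerMnl. Qed.

Hypothesis u_sqr : u * u = -1.

Lemma cisD s t : cis (s + t) = cis s * cis t.
Proof.
rewrite /cis cosD sinD mulrDl !mulrDr -!scalerAl -!scalerAr !mul1r mulr1 u_sqr.
rewrite !scalerA !scalerN !scalerDl scaleNr addrACA -!addrA; congr (_ + _).
rewrite [RHS]addrCA; congr (_ + _); rewrite addrC; congr (_ + _).
Qed.

Lemma cisMn t n : cis (t *+ n) = cis t ^+ n.
Proof. by elim: n => [|n IHn]; rewrite ?cis0 // mulrS cisD IHn exprS. Qed.

Lemma cis_2piMn n : cis (pi *+ 2 *+ n) = 1.
Proof. by rewrite cisMn /cis cos2pi sin2pi scale1r scale0r addr0 expr1n. Qed.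

Lemma cis_2pi_subn m n : cis (pi *+ 2 *+ m - pi *+ 2 *+ n) = 1.
Proof. by rewrite -[LHS]mulr1 -[X in _ * X = _](cis_2piMn n) -cisD subrK cis_2piMn. Qed.

(** The algebra need not be a division ring, so the factor [cis t - 1] of
    [cis t ^+ N - 1] is cancelled through its product with the conjugate
    [cis (- t) - 1], which is the real scalar [2 - 2 cos t]. *)
Lemma sum_cis_eq0 N t :
  cis (t *+ N) = 1 -> cos t != 1 -> \sum_(w < N) cis (t *+ w) = 0.
Proof.
move=> ct1 cost_neq1; set S := \sum_(_ < _) _.
have zS0 : (cis t - 1) * S = 0.
  rewrite /S; under eq_bigr do rewrite cisMn.
  by rewrite -subrX1 -cisMn ct1 subrr.
have norm_z1 : (cis (- t) - 1) * (cis t - 1) = ((1 - cos t) *+ 2)%:A.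
  rewrite mulrBl !mulrBr mul1r mulr1 mul1r -cisD addNr cis0.
  rewrite opprB addrACA -opprD [cis (- t) + _]addrC addr_cisN.
  by rewrite mulrnBl scalerBl [1 *+ 2]mulr2n [(1 + 1)%:A]scalerDl scale1r.
have := congr1 (fun v => (cis (- t) - 1) * v) zS0.
rewrite mulr0 mulrA norm_z1 -scalerAl mul1r => /eqP.
by rewrite scaler_eq0 mulrn_eq0 subr_eq0 [1 == _]eq_sym (negPf cost_neq1) => /eqP.
Qed.

End Cis.

(** By the half-angle formula [cos t = 1 - 2 sin (|t| / 2) ^ 2], this is the
    positivity of the sine inside a half period. *)
Lemma cos_neq1 (R : realType) (t : R) : 0 < `|t| < pi *+ 2 -> cos t != 1.
Proof.
move=> /andP[t_gt0 t_lt2pi].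
have -> : cos t = 1 - sin (`|t| / 2) ^+ 2 *+ 2.
  rewrite -[LHS]cos_norm {1}[`|t|]splitr cosD -!expr2.
  by have := cos2Dsin2 (`|t| / 2); lra.
rewrite subr_eq addrC -subr_eq subrr eq_sym mulrn_eq0 expf_eq0 /=.
by rewrite gt_eqF // sin_gt0_pi // divr_gt0 //= ltr_pdivrMr // mulr_natr.
Qed.

Section Kernel.
Variables (R : realType) (A : algType R) (u : A).
Hypothesis u_sqr : u * u = -1.
Variables (N : nat) (B : qpf_param R) (dt : R).

Lemma sum_cis_roots_of_unity (x y : 'I_N) : x != y ->
  \sum_(w < N) cis u (pi *+ 2 / N%:R * (x%:R - y%:R) *+ w) = 0.
Proof.
move=> x_neq_y; have N_gt0 : 0 < N%:R :> R.
  by rewrite ltr0n (leq_ltn_trans _ (ltn_ord x)).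
have pi2_gt0 : 0 < pi *+ 2 :> R by rewrite mulrn_wgt0 // pi_gt0.
apply: sum_cis_eq0 => //.
  rewrite -[X in cis u X]mulr_natr mulrAC divfK ?gt_eqF // mulrBr !mulr_natr.
  exact: cis_2pi_subn.
apply: cos_neq1; rewrite normrM gtr0_norm ?divr_gt0 //.
rewrite mulr_gt0 ?divr_gt0 ?normr_gt0 ?subr_eq0 ?eqr_nat //=.
rewrite -mulrA -[ltRHS]mulr1 ltr_pM2l // mulrC ltr_pdivrMr // mul1r.
rewrite ltr_norml; have := ltn_ord x; have := ltn_ord y; rewrite -!(ltr_nat R).
have := ler0n R x; have := ler0n R y; lra.
Qed.

(** Only the Fourier term of the phase couples [x] with [w], so all the rest of
    the difference is either cancelled or constant in [w]. *)
Lemma qpf_phaseB (x y w : 'I_N) :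
  qpf_phase B dt x w - qpf_phase B dt y w =
    (pa B * (x%:R ^+ 2 - y%:R ^+ 2) * dt ^+ 2 + pd B * (x%:R - y%:R) * dt)
    + pi *+ 2 / N%:R * (x%:R - y%:R) *+ w.
Proof. by rewrite /qpf_phase -[in RHS]mulr_natr -[pi *+ 2]mulr_natl; ring. Qed.

Lemma sum_cis_qpf_phase (x y : 'I_N) :
  \sum_(w < N) cis u (qpf_phase B dt x w - qpf_phase B dt y w) = (x == y)%:R *+ N.
Proof.
case: eqVneq => [<-|x_neq_y].
  under eq_bigr do rewrite subrr cis0.
  by rewrite sumr_const card_ord.
under eq_bigr do rewrite qpf_phaseB cisD //.
by rewrite -mulr_sumr sum_cis_roots_of_unity ?mulr0 ?mul0rn.
Qed.

(** The kernel of the reconstruction, a row for each sample and a column for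
    each frequency, and the kernel of the transform, with the roles exchanged. *)
Definition qpf_kernel : 'M[A]_N := \matrix_(x, w) cis u (qpf_phase B dt x w).
Definition qpf_kernelV : 'M[A]_N := \matrix_(w, x) cis u (- qpf_phase B dt x w).

Lemma qpf_kernel_mulmxV : qpf_kernel *m qpf_kernelV = 1%:M *+ N.
Proof.
apply/matrixP => x y; rewrite mulmxnE !mxE -sum_cis_qpf_phase.
by apply: eq_bigr => w _; rewrite !mxE -cisD.
Qed.

(** The second coordinate is transformed from the right, by the transposed
    kernels.  Transposition need not reverse products over a noncommutative ring,
    so this is drawn from the character sum again rather than by transposing
    [qpf_kernel_mulmxV]. *)
Lemma qpf_kernel_mulmxV_tr : qpf_kernelV^T *m qpf_kernel^T = 1%:M *+ N.
Proof.
apply/matrixP => x y; rewrite mulmxnE !mxE eq_sym -sum_cis_qpf_phase.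
by apply: eq_bigr => w _; rewrite !mxE -cisD // addrC.
Qed.

End Kernel.

Lemma dqqpft_mulmx (R : realType) (N1 N2 : nat) (B1 B2 : qpf_param R) (dt1 dt2 : R)
    (f : 'M[quat R]_(N1, N2)) (w1 : 'I_N1) (w2 : 'I_N2) :
  dqqpft B1 B2 dt1 dt2 f w1 w2 =
    (Num.sqrt (N1 * N2)%:R)^-1 *:
      (qpf_kernelV (qi R) N1 B1 dt1 *m f *m (qpf_kernelV (qj R) N2 B2 dt2)^T) w1 w2.
Proof.
rewrite !mxE exchange_big; congr (_ *: _); apply: eq_bigr => x2 _.
by rewrite !mxE mulr_suml; apply: eq_bigr => x1 _; rewrite !mxE.
Qed.

Theorem theorem3p6 (R : realType) (N1 N2 : nat) (hN1 : (0 < N1)%N) (hN2 : (0 < N2)%N)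
    (B1 B2 : qpf_param R) (hb1 : pb B1 != 0) (hb2 : pb B2 != 0)
    (dt1 dt2 : R) (hdt1 : 0 < dt1) (hdt2 : 0 < dt2)
    (f : 'M[quat R]_(N1, N2)) (x1 : 'I_N1) (x2 : 'I_N2) :
  f x1 x2 =
    ((Num.sqrt N1%:R)^-1 * (Num.sqrt N2%:R)^-1) *:
      \sum_(w1 < N1) \sum_(w2 < N2)
        expi (qpf_phase B1 dt1 x1 w1)
        * dqqpft B1 B2 dt1 dt2 f w1 w2
        * expj (qpf_phase B2 dt2 x2 w2).
Proof.
set K1 := qpf_kernel (qi R) N1 B1 dt1; set K1V := qpf_kernelV (qi R) N1 B1 dt1.
set K2 := qpf_kernel (qj R) N2 B2 dt2; set K2V := qpf_kernelV (qj R) N2 B2 dt2.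
pose c : R := Num.sqrt (N1 * N2)%:R.
have c_sqr : c * c = (N1 * N2)%:R by rewrite -expr2 sqr_sqrtr ?ler0n.
have c_neq0 : c != 0 by rewrite gt_eqF // sqrtr_gt0 ltr0n muln_gt0 hN1.
have -> : (Num.sqrt N1%:R)^-1 * (Num.sqrt N2%:R)^-1 = c^-1.
  by rewrite -invfM -sqrtrM ?ler0n // -natrM.
have -> : \sum_(w1 < N1) \sum_(w2 < N2)
    expi (qpf_phase B1 dt1 x1 w1) * dqqpft B1 B2 dt1 dt2 f w1 w2
    * expj (qpf_phase B2 dt2 x2 w2)
  = c^-1 *: (K1 *m (K1V *m f *m K2V^T) *m K2^T) x1 x2.
  rewrite !mxE exchange_big scaler_sumr; apply: eq_bigr => w2 _.
  rewrite !mxE mulr_suml scaler_sumr; apply: eq_bigr => w1 _.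
  by rewrite dqqpft_mulmx -scalerAr -scalerAl !mxE.
rewrite !mulmxA qpf_kernel_mulmxV ?qi_sqr // -mulmxA qpf_kernel_mulmxV_tr ?qj_sqr //.
(* scalar matrices need not be central here, but integer multiples of the
   identity are, by additivity of the product on each side *)
rewrite (raddfMn (mulmx _)) /= mulmx1 -/(mulmxr f _) raddfMn /= mul1mx !mulmxnE.
rewrite -mulrnA -scaler_nat !scalerA -c_sqr mulrA -!mulrA mulKf // mulVf //.
by rewrite scale1r.
Qed.
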